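(* Let $0<|q|<1$, $0<|p|<1$, $|x|<1$, $|y|<1$. (I) Let $a,b,c,d\in\mathbb{C}$ with $p^{c}\neq p^{-n}$ and $q^{d}\ne q^{-n}$ for all integers $n\ge 0$. Then $$\Psi_{1}(q^{a},p^{b};p^{c},q^{d};q,p,x,y)=\sum_{\ell=0}^{\infty}\frac{(q^{a};q)_{\ell}(p^{b};p)_{\ell}}{(p^{c};p)_{\ell}(p;p)_{\ell}}y^{\ell}\;{}_{2}\phi_{1}(q^{a+\ell},0;q^{d};q,x).$$ (II) Let $a,b,c\in\mathbb{C}$ with $p^{b}\neq p^{-n}$ and $q^{c}\ne q^{-n}$ for all integers $n\ge 0$. Then $$\Psi_{2}(q^{a};p^{b},q^{c};q,p,x,y)=\sum_{\ell=0}^{\infty}\frac{(q^{a};q)_{\ell}}{(p^{b};p)_{\ell}(p;p)_{\ell}}y^{\ell}\;{}_{2}\phi_{1}(q^{a+\ell},0;q^{c};q,x).$$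
   Context: $q,p\in\mathbb{C}$ are two independent bases with $0<|q|<1$, $0<|p|<1$; logarithms of $q$ and $p$ are fixed so that $q^{a}=e^{a\log q}$, $p^{b}=e^{b\log p}$ for complex exponents. The $q$-shifted factorial is $(A;q)_{0}=1$, $(A;q)_{k}=\prod_{r=0}^{k-1}(1-Aq^{r})$ for $k\ge1$ (similarly with base $p$; $(0;q)_k=1$). ${}_{2}\phi_{1}(A,B;C;q,x)=\sum_{k\ge0}\frac{(A;q)_k(B;q)_k}{(C;q)_k(q;q)_k}x^k$. The bibasic Humbert functions are, for $|x|,|y|<1$ and whenever no denominator factor vanishes, $$\Psi_{1}(q^{a},p^{b};p^{c},q^{d};q,p,x,y)=\sum_{\ell,k=0}^{\infty}\frac{(q^{a};q)_{k+\ell}(p^{b};p)_{\ell}}{(p^{c};p)_{\ell}(q^{d};q)_{k}(q;q)_{k}(p;p)_{\ell}}x^{k}y^{\ell},$$ $$\Psi_{2}(q^{a};p^{b},q^{c};q,p,x,y)=\sum_{\ell,k=0}^{\infty}\frac{(q^{a};q)_{k+\ell}}{(p^{b};p)_{\ell}(q^{c};q)_{k}(q;q)_{k}(p;p)_{\ell}}x^{k}y^{\ell}.$$ *)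

(* Defs.v *)
From Stdlib Require Import Reals List.
From Coquelicot Require Import Coquelicot.
Open Scope C_scope.

Definition Cexp (z : C) : C :=
  RtoC (exp (Re z)) * (cos (Im z), sin (Im z)).

(* The power [q^a] for the choice [lq] of a logarithm of [q]
   (that is, [Cexp lq = q]). *)
Definition cpower (lq a : C) : C := Cexp (a * lq).

Fixpoint qpoch (A q : C) (k : nat) : C :=
  match k with
  | O => 1
  | S r => qpoch A q r * (1 - A * q ^ r)
  end.

(* Coquelicot's [Series] is real-valued; this is its complex analogue, which is
   meaningful when [ex_series a] holds. *)
Definition CSeries (a : nat -> C) : C :=
  iota (T := C_CompleteNormedModule) (fun s : C => is_series a s).

(* A double series is summed unconditionally: the net of its sums over finite
   sets of index pairs (duplicate-free lists, ordered by inclusion)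
   converges to [s]. *)
Definition is_double_series (a : nat -> nat -> C) (s : C) : Prop :=
  forall eps : R, (0 < eps)%R ->
  exists L0 : list (nat * nat),
  forall L : list (nat * nat), NoDup L -> incl L0 L ->
  (Cmod (fold_right Cplus 0 (map (fun i => a (fst i) (snd i)) L) - s) < eps)%R.

Definition ex_double_series (a : nat -> nat -> C) : Prop :=
  exists s : C, is_double_series a s.

Definition CDoubleSeries (a : nat -> nat -> C) : C :=
  iota (T := C_CompleteNormedModule) (fun s : C => is_double_series a s).

Definition phi21_term (A B C' q x : C) (k : nat) : C :=
  qpoch A q k * qpoch B q k / (qpoch C' q k * qpoch q q k) * x ^ k.

Definition phi21 (A B C' q x : C) : C := CSeries (phi21_term A B C' q x).

Definition Psi1_term (A B C' D q p x y : C) (l k : nat) : C :=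
  qpoch A q (k + l) * qpoch B p l
  / (qpoch C' p l * qpoch D q k * qpoch q q k * qpoch p p l)
  * x ^ k * y ^ l.

Definition Psi1 (A B C' D q p x y : C) : C :=
  CDoubleSeries (Psi1_term A B C' D q p x y).

Definition Psi2_term (A B C' q p x y : C) (l k : nat) : C :=
  qpoch A q (k + l)
  / (qpoch B p l * qpoch C' q k * qpoch q q k * qpoch p p l)
  * x ^ k * y ^ l.

Definition Psi2 (A B C' q p x y : C) : C :=
  CDoubleSeries (Psi2_term A B C' q p x y).

(* Main.v *)
(** The identities are Fubini's theorem for the double series, since
    [(A;q)_(k+l) = (A;q)_l (A q^l;q)_k]. Absolute convergence holds because
    [(A;q)_k] is bounded in [k], and so is its inverse when no factor vanishes;
    hence the terms are dominated by a constant times [|x|^k |y|^l]. *)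

Require Import Defs.
From Stdlib Require Import Reals List Permutation Lra Lia.
From Coquelicot Require Import Coquelicot.
Open Scope C_scope.

(** * Finite sums over lists and square index sets *)

(** Kept over a general abelian monoid so that the same rules serve the complex terms and their real
    majorants. For complex terms it is convertible with the sum in [is_double_series]. *)
Definition lsum {G : AbelianMonoid} {I : Type} (f : I -> G) (L : list I) : G :=
  fold_right plus zero (map f L).

Lemma lsum_app {G : AbelianMonoid} {I : Type} (f : I -> G) (L L' : list I) :
  lsum f (L ++ L') = plus (lsum f L) (lsum f L').
Proof.
  induction L as [|i L IH]; unfold lsum in *; simpl.
  - now rewrite plus_zero_l.
  - now rewrite IH, plus_assoc.
Qed.

Lemma lsum_perm {G : AbelianMonoid} {I : Type} (f : I -> G) (L L' : list I) :
  Permutation L L' -> lsum f L = lsum f L'.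
Proof.
  induction 1; unfold lsum in *; simpl; try congruence.
  now rewrite !plus_assoc, (plus_comm (f y)).
Qed.

Lemma lsum_seq {G : AbelianMonoid} (f : nat -> G) (n : nat) :
  lsum f (seq 0 (S n)) = sum_n f n.
Proof.
  induction n as [|n IH].
  - rewrite sum_O. apply plus_zero_r.
  - rewrite seq_S, lsum_app, IH, sum_Sn. f_equal. apply plus_zero_r.
Qed.

Lemma lsum_list_prod {G : AbelianMonoid} {I J : Type} (f : I * J -> G)
    (L : list I) (M : list J) :
  lsum f (list_prod L M) = lsum (fun i => lsum (fun j => f (i, j)) M) L.
Proof.
  induction L as [|i L IH]; [easy|].
  simpl list_prod. rewrite lsum_app, IH. unfold lsum. simpl. now rewrite map_map.
Qed.

Lemma Cmod_lsum_le {I : Type} (f : I -> C) (g : I -> R) (L : list I) :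
  (forall i, Cmod (f i) <= g i)%R -> (Cmod (lsum f L) <= lsum g L)%R.
Proof.
  intros H. induction L as [|i L IH]; unfold lsum in *; simpl.
  - change (Cmod 0 <= 0)%R. rewrite Cmod_0. lra.
  - eapply Rle_trans; [apply Cmod_triangle|]. now apply Rplus_le_compat.
Qed.

Lemma lsum_nonneg {I : Type} (g : I -> R) (L : list I) :
  (forall i, 0 <= g i)%R -> (0 <= lsum g L)%R.
Proof.
  intros H. induction L as [|i L IH]; unfold lsum in *; simpl.
  - apply Rle_refl.
  - now apply Rplus_le_le_0_compat.
Qed.

(** Each element of [L0] is cut out of [L] in turn; since it does not recur in [L0], the rest of
    [L0] survives the cut. This lets a sum over [L] be split into a sum over [L0] and a
    remainder. *)
Lemma NoDup_incl_complement {I : Type} (L0 L : list I) :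
  NoDup L0 -> incl L0 L -> exists L', Permutation L (L0 ++ L').
Proof.
  revert L. induction L0 as [|i L0 IH]; intros L HN HI.
  - now exists L.
  - inversion HN as [|? ? Hi HN']; subst.
    destruct (in_split i L) as [L1 [L2 ->]]; [apply HI; now left|].
    destruct (IH (L1 ++ L2) HN') as [L' HP].
    + intros j Hj. assert (j <> i) by congruence.
      specialize (HI j (or_intror Hj)).
      apply in_app_or in HI. apply in_or_app.
      destruct HI as [?|[?|?]]; [now left|congruence|now right].
    + exists L'. rewrite <- Permutation_middle. simpl. now constructor.
Qed.

Lemma NoDup_list_prod {I J : Type} (L : list I) (M : list J) :
  NoDup L -> NoDup M -> NoDup (list_prod L M).
Proof.
  intros HL HM. induction HL as [|i L Hi HL IH]; simpl; [constructor|].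
  apply NoDup_app; [|exact IH|].
  - apply FinFun.Injective_map_NoDup; [|exact HM]. intros j j'; congruence.
  - intros [i' j] H1 H2. apply in_map_iff in H1. destruct H1 as [? [H1 _]].
    apply in_prod_iff in H2. injection H1 as -> _. tauto.
Qed.

(** Squares are cofinal among the finite index sets, and sums over them are iterated partial
    sums. *)
Definition square (n : nat) : list (nat * nat) :=
  list_prod (seq 0 (S n)) (seq 0 (S n)).

Lemma NoDup_square (n : nat) : NoDup (square n).
Proof. apply NoDup_list_prod; apply seq_NoDup. Qed.

Lemma incl_square (L : list (nat * nat)) : exists n, incl L (square n).
Proof.
  enough (exists n, forall i, In i L -> fst i <= n /\ snd i <= n)%nat as [n Hn].
  { exists n. intros [l k] Hi. apply Hn in Hi. simpl in Hi.
    apply in_prod; apply in_seq; lia. }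
  induction L as [|[l k] L [n Hn]].
  - now exists 0%nat.
  - exists (l + k + n)%nat. intros i [<-|Hi]; simpl; [lia|].
    apply Hn in Hi. lia.
Qed.

Lemma lsum_square {G : AbelianMonoid} (a : nat -> nat -> G) (n : nat) :
  lsum (fun i => a (fst i) (snd i)) (square n)
  = sum_n (fun l => sum_n (a l) n) n.
Proof.
  unfold square. rewrite lsum_list_prod, lsum_seq. apply sum_n_ext. intros l.
  apply (lsum_seq (a l)).
Qed.

(** Reduces the part of a product majorant outside a square to tails of two simple series. *)
Lemma lsum_square_mult (u v : nat -> R) (n : nat) :
  lsum (fun i => u (fst i) * v (snd i))%R (square n)
  = (sum_n u n * sum_n v n)%R.
Proof.
  rewrite (lsum_square (fun l k => u l * v k)%R).
  rewrite <- (sum_n_mult_r (K := R_Ring) (sum_n v n) u).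
  apply sum_n_ext. intros l. exact (sum_n_mult_l (K := R_Ring) (u l) v n).
Qed.

(** * Limits and tail estimates for simple series *)

Lemma is_series_C_lim (a : nat -> C) (s : C) (eps : R) :
  is_series a s -> (0 < eps)%R ->
  exists N, forall n, (N <= n)%nat -> (Cmod (sum_n a n - s) < eps)%R.
Proof.
  intros H He.
  destruct (proj1 (filterlim_locally_ball_norm (K := C_AbsRing) (sum_n a) s) H
              (mkposreal eps He)) as [N HN].
  exists N. exact HN.
Qed.

Lemma is_series_R_lim (a : nat -> R) (s : R) (eps : R) :
  is_series a s -> (0 < eps)%R ->
  exists N, forall n, (N <= n)%nat -> (Rabs (sum_n a n - s) < eps)%R.
Proof.
  intros H He.
  destruct (proj1 (filterlim_locally_ball_norm (K := R_AbsRing) (sum_n a) s) H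
              (mkposreal eps He)) as [N HN].
  exists N. exact HN.
Qed.

Lemma sum_n_le_series (u : nat -> R) (s : R) (n : nat) :
  (forall k, 0 <= u k)%R -> is_series u s -> (sum_n u n <= s)%R.
Proof.
  intros Hu Hs. apply (is_lim_seq_incr_compare (sum_n u)); [exact Hs|].
  intros m. rewrite sum_Sn. specialize (Hu (S m)).
  change (sum_n u m <= sum_n u m + u (S m))%R. lra.
Qed.

Lemma Cmod_sum_n_diff_le (a : nat -> C) (b : nat -> R) (n m : nat) :
  (forall k, Cmod (a k) <= b k)%R -> (n <= m)%nat ->
  (Cmod (sum_n a m - sum_n a n) <= sum_n b m - sum_n b n)%R.
Proof.
  intros H. induction 1 as [|m Hm IH].
  - replace (sum_n a n - sum_n a n) with (RtoC 0) by ring. rewrite Cmod_0. lra.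
  - rewrite !sum_Sn.
    change (Cmod (sum_n a m + a (S m) - sum_n a n)
            <= sum_n b m + b (S m) - sum_n b n)%R.
    replace (sum_n a m + a (S m) - sum_n a n)
      with ((sum_n a m - sum_n a n) + a (S m)) by ring.
    eapply Rle_trans; [apply Cmod_triangle|]. specialize (H (S m)). lra.
Qed.

(** The limit [s] is replaced, up to [eps], by a far partial sum of [a]; the difference of partial
    sums is bounded by that of [b], whose partial sums stay below [t]. *)
Lemma Cmod_series_tail_le (a : nat -> C) (b : nat -> R) (s : C) (t : R) (n : nat) :
  (forall k, Cmod (a k) <= b k)%R -> is_series a s -> is_series b t ->
  (Cmod (sum_n a n - s) <= t - sum_n b n)%R.
Proof.
  intros H Ha Hb. apply le_epsilon. intros eps He.
  destruct (is_series_C_lim a s eps Ha He) as [N HN].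
  set (m := (N + n)%nat).
  assert (H1 := HN m ltac:(lia)).
  assert (H2 := Cmod_sum_n_diff_le a b n m H ltac:(lia)).
  assert (H3 : (sum_n b m <= t)%R).
  { apply sum_n_le_series; [|exact Hb]. intros k.
    eapply Rle_trans; [apply Cmod_ge_0|apply H]. }
  replace (sum_n a n - s) with ((sum_n a m - s) + - (sum_n a m - sum_n a n)) by ring.
  eapply Rle_trans; [apply Cmod_triangle|]. rewrite Cmod_opp. lra.
Qed.

Lemma Cmod_series_le (a : nat -> C) (b : nat -> R) (s : C) (t : R) :
  (forall k, Cmod (a k) <= b k)%R -> is_series a s -> is_series b t ->
  (Cmod s <= t)%R.
Proof.
  intros H Ha Hb.
  assert (H1 := Cmod_series_tail_le a b s t 0 H Ha Hb).
  rewrite !sum_O in H1. specialize (H 0%nat).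
  replace s with (a 0%nat + - (a 0%nat - s)) by ring.
  eapply Rle_trans; [apply Cmod_triangle|]. rewrite Cmod_opp. lra.
Qed.

Lemma CSeries_unique (a : nat -> C) (s : C) : is_series a s -> CSeries a = s.
Proof.
  intros H. apply (iota_unique (V := C_CompleteNormedModule)); [|exact H].
  intros t Ht. exact (filterlim_locally_unique (V := C_NormedModule) _ _ _ Ht H).
Qed.

(** * Fubini's theorem under a product majorant, and uniqueness of the double sum *)

(** For [L] containing a large square, the error splits into three: the terms of [L] outside the
    square, the tails of the rows cut off by the square, and the tail of the series of row sums. *)
Lemma double_series_fubini (a : nat -> nat -> C) (u v : nat -> R) :
  (forall l, 0 <= u l)%R -> (forall k, 0 <= v k)%R ->
  ex_series u -> ex_series v ->
  (forall l k, Cmod (a l k) <= u l * v k)%R ->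
  exists s : C,
    (forall l, ex_series (a l)) /\ is_series (fun l => CSeries (a l)) s
    /\ is_double_series a s.
Proof.
  intros Hu Hv [U HU] [V HV] Ha.
  assert (HVl : forall l, is_series (fun k => u l * v k)%R (u l * V)%R).
  { intros l. exact (is_series_scal (K := R_AbsRing) (u l) v V HV). }
  assert (HA : forall l, ex_series (a l)).
  { intros l.
    apply (ex_series_le (V := C_CompleteNormedModule) (a l) (fun k => u l * v k)%R).
    - exact (Ha l).
    - eexists; apply HVl. }
  set (A := fun l => CSeries (a l)).
  assert (HA' : forall l, is_series (a l) (A l)).
  { intros l. destruct (HA l) as [s Hs]. unfold A.
    now rewrite (CSeries_unique _ _ Hs). }
  assert (HAb : forall l, (Cmod (A l) <= u l * V)%R).
  { intros l. exact (Cmod_series_le _ _ _ _ (Ha l) (HA' l) (HVl l)). }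
  assert (Hs : ex_series A).
  { apply (ex_series_le (V := C_CompleteNormedModule) A (fun l => u l * V)%R HAb).
    exists (U * V)%R. exact (is_series_scal_r V u U HU). }
  destruct Hs as [s Hs].
  exists s. split; [exact HA|split; [exact Hs|]].
  intros eps He.
  assert (HU0 : (0 <= U)%R).
  { eapply Rle_trans; [apply (Hu 0%nat)|]. rewrite <- (sum_O u).
    now apply sum_n_le_series. }
  assert (HV0 : (0 <= V)%R).
  { eapply Rle_trans; [apply (Hv 0%nat)|]. rewrite <- (sum_O v).
    now apply sum_n_le_series. }
  (* Chosen so that the first two errors, at most [U * d + V * d] and [U * d], use up no more than
     [eps / 2]; the [+ 1] keeps the denominator positive when [U = V = 0]. *)
  set (d := (eps / (4 * (U + V + 1)))%R).
  assert (Hd : (0 < d)%R) by (apply Rdiv_lt_0_compat; lra).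
  assert (Hd' : (U * d + V * d + U * d <= eps / 2)%R).
  { assert (E : (eps / 2 = 2 * (U + V + 1) * d)%R) by (unfold d; field; lra).
    rewrite E. nra. }
  destruct (is_series_C_lim A s (eps / 2) Hs ltac:(lra)) as [N1 HN1].
  destruct (is_series_R_lim u U d HU Hd) as [N2 HN2].
  destruct (is_series_R_lim v V d HV Hd) as [N3 HN3].
  set (N := (N1 + N2 + N3)%nat).
  specialize (HN1 N ltac:(lia)). specialize (HN2 N ltac:(lia)).
  specialize (HN3 N ltac:(lia)).
  apply Rabs_def2 in HN2. apply Rabs_def2 in HN3.
  assert (HUN := fun n => sum_n_le_series u U n Hu HU).
  assert (HVN := fun n => sum_n_le_series v V n Hv HV).
  exists (square N). intros L HL HI.
  set (f := fun i : nat * nat => a (fst i) (snd i)).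
  set (g := fun i : nat * nat => (u (fst i) * v (snd i))%R).
  assert (Hg : forall i, (0 <= g i)%R) by (intros i; now apply Rmult_le_pos).
  change (Cmod (lsum f L - s) < eps)%R.
  destruct (NoDup_incl_complement (square N) L (NoDup_square N) HI) as [L' HL'].
  assert (T1 : (Cmod (lsum f L') <= U * d + V * d)%R).
  { apply Rle_trans with (lsum g L').
    { apply Cmod_lsum_le. intros i. apply Ha. }
    (* Enclosing [L] in a larger square bounds the majorant over [L'] by the difference of the
       majorant sums over the two squares. *)
    destruct (incl_square L) as [n Hn].
    destruct (NoDup_incl_complement L (square n) HL Hn) as [L'' HL''].
    assert (E : (lsum g (square n) = lsum g (square N) + lsum g L' + lsum g L'')%R).
    { rewrite (lsum_perm g _ _ HL''), lsum_app, (lsum_perm g _ _ HL'), lsum_app.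
      reflexivity. }
    unfold g in E. rewrite !lsum_square_mult in E. fold g in E.
    assert (H0 := lsum_nonneg g L'' Hg).
    specialize (HUN n) as H1. specialize (HVN n) as H2.
    assert (H3 : (0 <= sum_n v n)%R).
    { rewrite <- lsum_seq. now apply lsum_nonneg. }
    assert (sum_n u n * sum_n v n <= U * V)%R by nra.
    specialize (HUN N) as H4. specialize (HVN N) as H5.
    assert (H6 : (0 <= sum_n v N)%R).
    { rewrite <- lsum_seq. now apply lsum_nonneg. }
    (* With [u_N], [v_N] the partial sums, [U V - u_N v_N = (U - u_N) v_N + U (V - v_N)]; each
       summand is estimated separately. *)
    assert ((U - sum_n u N) * sum_n v N <= d * V)%R
      by (apply Rmult_le_compat; lra).
    assert (U * (V - sum_n v N) <= U * d)%R by (apply Rmult_le_compat_l; lra).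
    nra. }
  (* Cutting row [l] at [N] costs at most [u l] times the tail of [v], hence at most [u l * d];
     summing over the rows gives [U * d]. *)
  assert (T2 : (Cmod (lsum f (square N) - sum_n A N) <= U * d)%R).
  { unfold f. rewrite lsum_square.
    set (B := fun l => sum_n (a l) N - A l).
    assert (E0 : sum_n (fun l => sum_n (a l) N) N = sum_n B N + sum_n A N).
    { etransitivity; [|exact (sum_n_plus (G := C_AbelianMonoid) B A N)].
      apply sum_n_ext. intros l. unfold B.
      generalize (sum_n (a l) N) (A l).
      change (forall b c : C, @eq C b (b - c + c)). intros b c. ring. }
    assert (E1 : forall b c : C, b + c - c = b) by (intros; ring).
    rewrite E0, E1.
    rewrite <- lsum_seq.
    apply Rle_trans with (lsum (fun l => u l * d)%R (seq 0 (S N))).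
    - apply Cmod_lsum_le. intros l. unfold B.
      eapply Rle_trans; [exact (Cmod_series_tail_le _ _ _ _ N (Ha l) (HA' l) (HVl l))|].
      assert (E := sum_n_mult_l (K := R_Ring) (u l) v N).
      change (sum_n (fun k => u l * v k)%R N = u l * sum_n v N)%R in E.
      rewrite E. specialize (Hu l). nra.
    - rewrite lsum_seq.
      assert (E := sum_n_mult_r (K := R_Ring) d u N).
      change (sum_n (fun k => u k * d)%R N = sum_n u N * d)%R in E.
      rewrite E. apply Rmult_le_compat_r; [lra|apply HUN]. }
  rewrite (lsum_perm f _ _ HL'), lsum_app.
  change (Cmod (lsum f (square N) + lsum f L' - s) < eps)%R.
  replace (lsum f (square N) + lsum f L' - s)
    with ((lsum f L' + (lsum f (square N) - sum_n A N)) + (sum_n A N - s)) by ring.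
  eapply Rle_lt_trans; [apply Cmod_triangle|].
  assert (H := Cmod_triangle (lsum f L') (lsum f (square N) - sum_n A N)).
  lra.
Qed.

(** The index lists belonging to [s] and [t] are merged into one duplicate-free list, whose sum is
    within [eps / 2] of both. *)
Lemma is_double_series_unique (a : nat -> nat -> C) (s t : C) :
  is_double_series a s -> is_double_series a t -> s = t.
Proof.
  intros Hs Ht.
  enough (H : (Cmod (t - s) <= 0)%R).
  { assert (E : t - s = 0).
    { apply Cmod_eq_0. apply Rle_antisym; [exact H|apply Cmod_ge_0]. }
    replace t with (t - s + s) by ring. rewrite E. ring. }
  apply le_epsilon. intros eps He.
  destruct (Hs (eps / 2)%R ltac:(lra)) as [L1 H1].
  destruct (Ht (eps / 2)%R ltac:(lra)) as [L2 H2].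
  assert (dec : forall i j : nat * nat, {i = j} + {i <> j}).
  { decide equality; apply Nat.eq_dec. }
  set (L := nodup dec (L1 ++ L2)).
  assert (HL : NoDup L) by apply NoDup_nodup.
  specialize (H1 L HL). specialize (H2 L HL).
  set (w := fold_right _ _ _) in *.
  assert (K1 : incl L1 L).
  { intros i Hi. apply nodup_In, in_or_app. now left. }
  assert (K2 : incl L2 L).
  { intros i Hi. apply nodup_In, in_or_app. now right. }
  specialize (H1 K1). specialize (H2 K2).
  replace (t - s) with ((w - s) + - (w - t)) by ring.
  eapply Rle_trans; [apply Cmod_triangle|]. rewrite Cmod_opp. lra.
Qed.

Lemma CDoubleSeries_unique (a : nat -> nat -> C) (s : C) :
  is_double_series a s -> CDoubleSeries a = s.
Proof.
  intros H. apply (iota_unique (V := C_CompleteNormedModule)); [|exact H].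
  intros t Ht. exact (is_double_series_unique a t s Ht H).
Qed.


(** * Boundedness of shifted factorials and of their inverses *)

(** By [1 + t <= exp t], the product of the factors [1 + K * rho ^ k] is at most the exponential of
    a geometric sum. The induction carries the partial geometric sum, which is bounded by the full
    one at the end. *)
Lemma le_exp_of_growth (P : nat -> R) (K rho : R) :
  (0 <= K)%R -> (0 <= rho < 1)%R ->
  (forall k, 0 <= P k)%R -> (forall k, P (S k) <= P k * (1 + K * rho ^ k))%R ->
  forall k, (P k <= P 0%nat * exp (K / (1 - rho)))%R.
Proof.
  intros HK Hr HP HS k.
  assert (H : (P k <= P 0%nat * exp (K * ((1 - rho ^ k) / (1 - rho))))%R).
  { induction k as [|k IH].
    - simpl. replace (K * ((1 - 1) / (1 - rho)))%R with 0%R by (field; lra).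
      rewrite exp_0. lra.
    - replace (K * ((1 - rho ^ S k) / (1 - rho)))%R
        with (K * ((1 - rho ^ k) / (1 - rho)) + K * rho ^ k)%R
        by (simpl; field; lra).
      rewrite exp_plus, <- Rmult_assoc.
      eapply Rle_trans; [apply HS|].
      assert (0 <= rho ^ k)%R by (apply pow_le; lra).
      apply Rmult_le_compat; auto; [nra|apply exp_ineq1_le]. }
  eapply Rle_trans; [exact H|]. apply Rmult_le_compat_l; [apply HP|].
  assert (H0 : (0 <= rho ^ k)%R) by (apply pow_le; lra).
  assert (Hle : (K * ((1 - rho ^ k) / (1 - rho)) <= K / (1 - rho))%R).
  { unfold Rdiv. apply Rmult_le_compat_l; [exact HK|].
    assert (0 < / (1 - rho))%R by (apply Rinv_0_lt_compat; lra). nra. }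
  destruct Hle as [Hlt| ->]; [left; now apply exp_increasing|apply Rle_refl].
Qed.

Lemma Cmod_factor_le (A q : C) (r : nat) :
  (Cmod (1 - A * q ^ r) <= 1 + Cmod A * Cmod q ^ r)%R.
Proof.
  eapply Rle_trans; [apply Cmod_triangle|].
  rewrite Cmod_opp, Cmod_1, Cmod_mult, Cmod_pow. apply Rle_refl.
Qed.

Lemma qpoch_bounded (A q : C) :
  (Cmod q < 1)%R -> exists M, forall k, (Cmod (qpoch A q k) <= M)%R.
Proof.
  intros Hq. eexists. apply (le_exp_of_growth _ (Cmod A) (Cmod q)).
  - apply Cmod_ge_0.
  - split; [apply Cmod_ge_0|exact Hq].
  - intros k. apply Cmod_ge_0.
  - intros k. simpl qpoch. rewrite Cmod_mult.
    apply Rmult_le_compat_l; [apply Cmod_ge_0|apply Cmod_factor_le].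
Qed.

(** The factors tend to 1, so all but finitely many have modulus at least 1/2; the remaining ones
    have a positive minimum. *)
Lemma factor_away_from_0 (A q : C) :
  (Cmod q < 1)%R -> (forall n, 1 - A * q ^ n <> 0) ->
  exists d, (0 < d)%R /\ forall n, (d <= Cmod (1 - A * q ^ n))%R.
Proof.
  intros Hq H0.
  assert (Hfin : forall N, exists d, (0 < d)%R /\
                 forall n, (n < N)%nat -> (d <= Cmod (1 - A * q ^ n))%R).
  { induction N as [|N [d [Hd IH]]].
    - exists 1%R. split; [lra|]. intros n Hn. lia.
    - exists (Rmin d (Cmod (1 - A * q ^ N))). split.
      + apply Rmin_pos; [exact Hd|]. now apply Cmod_gt_0.
      + intros n Hn. destruct (Nat.eq_dec n N) as [->|Hne]; [apply Rmin_r|].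
        eapply Rle_trans; [apply Rmin_l|apply IH; lia]. }
  assert (HA := Cmod_ge_0 A). assert (Hq0 := Cmod_ge_0 q).
  (* This threshold forces [Cmod A * Cmod q ^ n <= / 2]; the [+ 1] covers [A = 0]. *)
  destruct (pow_lt_1_zero (Cmod q)) with (y := (/ (2 * (Cmod A + 1)))%R)
    as [N HN].
  { now rewrite Rabs_pos_eq. }
  { apply Rinv_0_lt_compat. lra. }
  destruct (Hfin N) as [d [Hd Hd']].
  exists (Rmin d (/ 2)). split; [apply Rmin_pos; lra|].
  intros n. destruct (Nat.lt_ge_cases n N) as [Hn|Hn].
  - eapply Rle_trans; [apply Rmin_l|now apply Hd'].
  - eapply Rle_trans; [apply Rmin_r|].
    specialize (HN n Hn). assert (Hp : (0 <= Cmod q ^ n)%R) by now apply pow_le.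
    rewrite Rabs_pos_eq in HN by exact Hp.
    assert (Hs : (Cmod A * Cmod q ^ n <= / 2)%R).
    { apply Rle_trans with ((Cmod A + 1) * / (2 * (Cmod A + 1)))%R.
      - apply Rmult_le_compat; lra.
      - right. field. lra. }
    assert (Ht := Cmod_triangle (1 - A * q ^ n) (A * q ^ n)).
    replace (1 - A * q ^ n + A * q ^ n) with (RtoC 1) in Ht by ring.
    rewrite Cmod_1, (Cmod_mult A), Cmod_pow in Ht. lra.
Qed.

Lemma qpoch_neq_0 (A q : C) (k : nat) :
  (forall n, 1 - A * q ^ n <> 0) -> qpoch A q k <> 0.
Proof.
  intros H. induction k as [|k IH]; simpl.
  - apply C1_nz.
  - now apply Cmult_neq_0.
Qed.

(** The inverses obey the same growth condition as the factorials, with [Cmod A] divided by the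
    uniform lower bound [d] of the factors. *)
Lemma qpoch_inv_bounded (A q : C) :
  (Cmod q < 1)%R -> (forall n, 1 - A * q ^ n <> 0) ->
  exists M, forall k, (Cmod (/ qpoch A q k) <= M)%R.
Proof.
  intros Hq H0. destruct (factor_away_from_0 A q Hq H0) as [d [Hd Hd']].
  eexists. apply (le_exp_of_growth _ (Cmod A / d) (Cmod q)).
  - apply Rmult_le_pos; [apply Cmod_ge_0|left; now apply Rinv_0_lt_compat].
  - split; [apply Cmod_ge_0|exact Hq].
  - intros k. apply Cmod_ge_0.
  - intros k. simpl qpoch.
    assert (Hk := qpoch_neq_0 A q k H0). specialize (H0 k).
    (* 1 / (1 - z) = 1 + z / (1 - z) *)
    replace (/ (qpoch A q k * (1 - A * q ^ k)))
      with (/ qpoch A q k * (1 + A * q ^ k * / (1 - A * q ^ k)))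
      by (field; now split).
    rewrite Cmod_mult. apply Rmult_le_compat_l; [apply Cmod_ge_0|].
    eapply Rle_trans; [apply Cmod_triangle|].
    rewrite Cmod_1, !Cmod_mult, Cmod_pow, Cmod_inv by exact H0.
    apply Rplus_le_compat_l.
    replace (Cmod A / d * Cmod q ^ k)%R with (Cmod A * Cmod q ^ k * / d)%R
      by (unfold Rdiv; ring).
    apply Rmult_le_compat_l.
    + apply Rmult_le_pos; [|apply pow_le]; apply Cmod_ge_0.
    + now apply Rinv_le_contravar.
Qed.

(** * Algebra of shifted factorials, complex powers and nonvanishing factors *)

(** Used in both directions: to factor a row out of the double series, and to recombine the two
    factors for a bound uniform in [l]. *)
Lemma qpoch_add (A q : C) (l k : nat) :
  qpoch A q (k + l) = qpoch A q l * qpoch (A * q ^ l) q k.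
Proof.
  induction k as [|k IH]; simpl.
  - ring.
  - rewrite IH, Cpow_add_r. ring.
Qed.

Lemma qpoch_0 (q : C) (k : nat) : qpoch 0 q k = 1.
Proof. induction k as [|k IH]; simpl; [|rewrite IH]; ring. Qed.

Lemma Cexp_plus (z w : C) : Cexp (z + w) = Cexp z * Cexp w.
Proof.
  destruct z as [a b], w as [c d]. unfold Cexp, RtoC, Cplus, Cmult; simpl.
  rewrite exp_plus, cos_plus, sin_plus. f_equal; ring.
Qed.

Lemma Cexp_nat_mult (z : C) (n : nat) : Cexp (INR n * z) = Cexp z ^ n.
Proof.
  induction n as [|n IH].
  - simpl. replace (0 * z) with (RtoC 0) by ring.
    unfold Cexp, RtoC, Cmult; simpl. rewrite exp_0, cos_0, sin_0. f_equal; ring.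
  - rewrite S_INR, RtoC_plus, Cpow_S, <- IH, <- Cexp_plus. f_equal. ring.
Qed.

Lemma cpower_add_nat (lq a : C) (n : nat) :
  cpower lq (a + INR n) = cpower lq a * Cexp lq ^ n.
Proof.
  unfold cpower. rewrite <- Cexp_nat_mult, <- Cexp_plus. f_equal. ring.
Qed.

(** Brings the parameter conditions of the theorem into the form that the bounds on inverses
    require. *)
Lemma factor_neq_0 (A q : C) :
  q <> 0 -> (forall n, A <> / (q ^ n)) -> forall n, 1 - A * q ^ n <> 0.
Proof.
  intros Hq H n E. apply (H n).
  assert (Hn := Cpow_nz q n Hq).
  replace A with (A * q ^ n * / q ^ n) by (field; exact Hn).
  replace (A * q ^ n) with (1 - (1 - A * q ^ n)) by ring. rewrite E. ring.
Qed.

(** A vanishing factor would give [q * q ^ n] modulus 1, but its modulus is at most [Cmod q]. *)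
Lemma factor_self_neq_0 (q : C) (n : nat) : (Cmod q < 1)%R -> 1 - q * q ^ n <> 0.
Proof.
  intros Hq E.
  assert (H : Cmod (q * q ^ n) = 1%R).
  { replace (q * q ^ n) with (1 - (1 - q * q ^ n)) by ring.
    rewrite E. replace (1 - 0) with (RtoC 1) by ring. apply Cmod_1. }
  rewrite Cmod_mult, Cmod_pow in H.
  assert (H0 := Cmod_ge_0 q).
  assert (0 <= Cmod q ^ n)%R by now apply pow_le.
  assert (Cmod q ^ n <= 1)%R by (rewrite <- (pow1 n); apply pow_incr; lra).
  nra.
Qed.

(** * Majorants for the rows and summation by rows *)

(** The constant [K] comes from the denominators alone and precedes [A], because [A] changes from
    row to row; its factorial stays explicit for later recombination. *)
Lemma phi21_term_bounded (D q x : C) :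
  (Cmod q < 1)%R -> (forall n, 1 - D * q ^ n <> 0) ->
  exists K, (0 <= K)%R /\ forall A k,
    (Cmod (phi21_term A 0 D q x k) <= Cmod (qpoch A q k) * (K * Cmod x ^ k))%R.
Proof.
  intros Hq HD.
  destruct (qpoch_inv_bounded D q Hq HD) as [M1 H1].
  destruct (qpoch_inv_bounded q q Hq (fun n => factor_self_neq_0 q n Hq)) as [M2 H2].
  assert (P1 := Rle_trans _ _ _ (Cmod_ge_0 _) (H1 0%nat)).
  assert (P2 := Rle_trans _ _ _ (Cmod_ge_0 _) (H2 0%nat)).
  exists (M1 * M2)%R. split; [now apply Rmult_le_pos|].
  intros A k.
  assert (E : phi21_term A 0 D q x k
              = qpoch A q k * (/ qpoch D q k * / qpoch q q k * x ^ k)).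
  { unfold phi21_term. rewrite qpoch_0. field.
    split; apply qpoch_neq_0; auto using factor_self_neq_0. }
  rewrite E, !Cmod_mult, Cmod_pow.
  assert (0 <= Cmod x ^ k)%R by (apply pow_le, Cmod_ge_0).
  apply Rmult_le_compat_l; [apply Cmod_ge_0|].
  apply Rmult_le_compat_r; auto. apply Rmult_le_compat; auto using Cmod_ge_0.
Qed.

Lemma ex_series_scal_geom (c r : R) :
  (0 <= r < 1)%R -> ex_series (fun n => c * r ^ n)%R.
Proof.
  intros Hr. exists (c * / (1 - r))%R.
  apply (is_series_scal (K := R_AbsRing) c (fun n => r ^ n)%R).
  apply is_series_geom. rewrite Rabs_pos_eq; lra.
Qed.

Lemma ex_series_phi21 (A D q x : C) :
  (Cmod q < 1)%R -> (Cmod x < 1)%R -> (forall n, 1 - D * q ^ n <> 0) ->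
  ex_series (phi21_term A 0 D q x).
Proof.
  intros Hq Hx HD.
  destruct (qpoch_bounded A q Hq) as [M HM].
  destruct (phi21_term_bounded D q x Hq HD) as [K [HK0 HK]].
  apply (ex_series_le (V := C_CompleteNormedModule) _
           (fun k => M * K * Cmod x ^ k)%R).
  - intros k. rewrite Rmult_assoc. eapply Rle_trans; [apply HK|].
    apply Rmult_le_compat_r; [|apply HM].
    apply Rmult_le_pos; [exact HK0|apply pow_le, Cmod_ge_0].
  - apply ex_series_scal_geom. split; [apply Cmod_ge_0|exact Hx].
Qed.

(** Common core of both identities: [w] collects the factorials in base [p], and [B l] stands for
    [q^(a+l)]. *)
Lemma double_series_by_rows (A D q x y : C) (B w : nat -> C) (W : R)
    (a : nat -> nat -> C) (r : nat -> C) :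
  (Cmod q < 1)%R -> (Cmod x < 1)%R -> (Cmod y < 1)%R ->
  (forall n, 1 - D * q ^ n <> 0) ->
  (forall l, B l = A * q ^ l) -> (forall l, Cmod (w l) <= W)%R ->
  (forall l k, a l k =
     w l * y ^ l * qpoch A q l * phi21_term (B l) 0 D q x k) ->
  (forall l, r l = w l * y ^ l * qpoch A q l * phi21 (B l) 0 D q x) ->
  ex_double_series a /\ (forall l, ex_series (phi21_term (B l) 0 D q x))
  /\ ex_series r /\ CDoubleSeries a = CSeries r.
Proof.
  intros Hq Hx Hy HD HB HW Ha Hr.
  destruct (qpoch_bounded A q Hq) as [M HM].
  destruct (phi21_term_bounded D q x Hq HD) as [K [HK0 HK]].
  assert (HW0 := Rle_trans _ _ _ (Cmod_ge_0 _) (HW 0%nat)).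
  assert (HM0 := Rle_trans _ _ _ (Cmod_ge_0 _) (HM 0%nat)).
  assert (Hyl : forall l, (0 <= Cmod y ^ l)%R) by (intros; apply pow_le, Cmod_ge_0).
  assert (Hxk : forall k, (0 <= Cmod x ^ k)%R) by (intros; apply pow_le, Cmod_ge_0).
  destruct (double_series_fubini a (fun l => W * M * Cmod y ^ l)%R
              (fun k => K * Cmod x ^ k)%R) as [s [_ [Hs1 Hs2]]].
  - intros l. repeat apply Rmult_le_pos; auto.
  - intros k. apply Rmult_le_pos; auto.
  - apply ex_series_scal_geom. split; [apply Cmod_ge_0|exact Hy].
  - apply ex_series_scal_geom. split; [apply Cmod_ge_0|exact Hx].
  - intros l k.
    assert (E : a l k = w l * y ^ l *
              (qpoch A q l * phi21_term (B l) 0 D q x k))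
      by (rewrite Ha; ring).
    rewrite E, !Cmod_mult, Cmod_pow.
    replace (W * M * Cmod y ^ l * (K * Cmod x ^ k))%R
      with (W * Cmod y ^ l * (M * (K * Cmod x ^ k)))%R by ring.
    apply Rmult_le_compat.
    + apply Rmult_le_pos; auto using Cmod_ge_0.
    + apply Rmult_le_pos; auto using Cmod_ge_0.
    + now apply Rmult_le_compat_r.
    + eapply Rle_trans; [apply Rmult_le_compat_l; [apply Cmod_ge_0|apply HK]|].
      (* The product of [qpoch A q l] and [qpoch (A * q ^ l) q k] is again a factorial of [A], so
         the single bound [M] covers every row. *)
      rewrite <- Rmult_assoc, <- Cmod_mult, HB, <- qpoch_add.
      apply Rmult_le_compat_r; [now apply Rmult_le_pos|apply HM].
  - assert (Hs : is_series r s).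
    { apply (is_series_ext (fun l => CSeries (a l))); [|exact Hs1].
      intros l. rewrite Hr. apply CSeries_unique.
      destruct (ex_series_phi21 (B l) D q x Hq Hx HD) as [t Ht].
      unfold phi21. rewrite (CSeries_unique _ _ Ht).
      apply (is_series_ext (fun k => w l * y ^ l * qpoch A q l *
               phi21_term (B l) 0 D q x k)).
      - intros k. symmetry. apply Ha.
      - exact (is_series_scal (K := C_AbsRing) (V := C_NormedModule) _ _ _ Ht). }
    split; [now exists s|]. split; [intros l; now apply ex_series_phi21|].
    split; [now exists s|].
    rewrite (CSeries_unique _ _ Hs). now apply CDoubleSeries_unique.
Qed.

(** * Reduction of both Humbert functions to series of basic hypergeometric rows *)

Theorem theorem2p9 :
  forall q p lq lp x y : C,
  Cexp lq = q -> Cexp lp = p ->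
  (0 < Cmod q < 1)%R -> (0 < Cmod p < 1)%R ->
  (Cmod x < 1)%R -> (Cmod y < 1)%R ->
  (forall a b c d : C,
     (forall n : nat, cpower lp c <> / (p ^ n)) ->
     (forall n : nat, cpower lq d <> / (q ^ n)) ->
     let rhs_term := fun l : nat =>
       qpoch (cpower lq a) q l * qpoch (cpower lp b) p l
       / (qpoch (cpower lp c) p l * qpoch p p l) * y ^ l
       * phi21 (cpower lq (a + INR l)) 0 (cpower lq d) q x in
     ex_double_series
       (Psi1_term (cpower lq a) (cpower lp b) (cpower lp c) (cpower lq d)
          q p x y)
     /\ (forall l : nat,
           ex_series
             (phi21_term (cpower lq (a + INR l)) 0 (cpower lq d) q x))
     /\ ex_series rhs_term
     /\ Psi1 (cpower lq a) (cpower lp b) (cpower lp c) (cpower lq d) q p x y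
        = CSeries rhs_term)
  /\
  (forall a b c : C,
     (forall n : nat, cpower lp b <> / (p ^ n)) ->
     (forall n : nat, cpower lq c <> / (q ^ n)) ->
     let rhs_term := fun l : nat =>
       qpoch (cpower lq a) q l
       / (qpoch (cpower lp b) p l * qpoch p p l) * y ^ l
       * phi21 (cpower lq (a + INR l)) 0 (cpower lq c) q x in
     ex_double_series
       (Psi2_term (cpower lq a) (cpower lp b) (cpower lq c) q p x y)
     /\ (forall l : nat,
           ex_series
             (phi21_term (cpower lq (a + INR l)) 0 (cpower lq c) q x))
     /\ ex_series rhs_term
     /\ Psi2 (cpower lq a) (cpower lp b) (cpower lq c) q p x y
        = CSeries rhs_term).
Proof.
  intros q p lq lp x y Eq Ep [Hq0 Hq] [Hp0 Hp] Hx Hy.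
  apply Cmod_gt_0 in Hq0. apply Cmod_gt_0 in Hp0.
  assert (Ha : forall a l, cpower lq (a + INR l) = cpower lq a * q ^ l)
    by (intros; rewrite <- Eq; apply cpower_add_nat).
  assert (Hqq := fun n => factor_self_neq_0 q n Hq).
  assert (Hpp := fun n => factor_self_neq_0 p n Hp).
  (* The bound on the inverse of [qpoch p p l] is shared by both identities. *)
  destruct (qpoch_inv_bounded p p Hp Hpp) as [M1 H1].
  split.
  - intros a b c d Hc Hd rhs_term.
    pose proof (factor_neq_0 _ p Hp0 Hc) as Hc'.
    pose proof (factor_neq_0 _ q Hq0 Hd) as Hd'.
    destruct (qpoch_bounded (cpower lp b) p Hp) as [M2 H2].
    destruct (qpoch_inv_bounded (cpower lp c) p Hp Hc') as [M3 H3].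
    (* The weight is the base-[p] quotient in row [l], bounded factor by factor. *)
    apply (double_series_by_rows (cpower lq a) (cpower lq d) q x y
             (fun l => cpower lq (a + INR l))
             (fun l => qpoch (cpower lp b) p l
                * (/ qpoch (cpower lp c) p l * / qpoch p p l))
             (M2 * (M3 * M1))); auto.
    + intros l. rewrite !Cmod_mult.
      repeat (apply Rmult_le_compat; auto using Cmod_ge_0, Rmult_le_pos).
    + intros l k. unfold Psi1_term, phi21_term.
      rewrite qpoch_add, qpoch_0, Ha. field. repeat split; now apply qpoch_neq_0.
    + intros l. unfold rhs_term. field. split; now apply qpoch_neq_0.
  - intros a b c Hb Hc rhs_term.
    pose proof (factor_neq_0 _ p Hp0 Hb) as Hb'.
    pose proof (factor_neq_0 _ q Hq0 Hc) as Hc'.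
    destruct (qpoch_inv_bounded (cpower lp b) p Hp Hb') as [M2 H2].
    (* Here the weight has only the two inverse factorials, as the numerator contains none in base
       [p]. *)
    apply (double_series_by_rows (cpower lq a) (cpower lq c) q x y
             (fun l => cpower lq (a + INR l))
             (fun l => / qpoch (cpower lp b) p l * / qpoch p p l)
             (M2 * M1)); auto.
    + intros l. rewrite Cmod_mult. apply Rmult_le_compat; auto using Cmod_ge_0.
    + intros l k. unfold Psi2_term, phi21_term.
      rewrite qpoch_add, qpoch_0, Ha. field. repeat split; now apply qpoch_neq_0.
    + intros l. unfold rhs_term. field. split; now apply qpoch_neq_0.
Qed.
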